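(* Let $k\ge1$ be an integer, $\lambda_1,\lambda_2>0$, and let $S^k(t)=N_1^k(t)-N_2^k(t)$ be the Skellam process of order $k$, where $N_1^k,N_2^k$ are independent Poisson processes of order $k$ with intensities $\lambda_1,\lambda_2$. The Lévy measure of $S^k$ is $$\nu_{S^k}(x)=\lambda_1\sum_{j=1}^k\delta_j(x)+\lambda_2\sum_{j=1}^k\delta_{-j}(x).$$
   Context: The Poisson process of order $k$ with intensity $\lambda>0$ is the Lévy process $\{N^k(t)\}_{t\ge0}$ with $N^k(0)=0$ and $\mathbb{P}(N^k(t)=n)=\sum_{(x_1,\dots,x_k)\in\Omega(k,n)}e^{-k\lambda t}\frac{(\lambda t)^{x_1+\cdots+x_k}}{x_1!\cdots x_k!}$ for $n=0,1,2,\dots$, where $\Omega(k,n)$ is the set of $k$-tuples of non-negative integers with $x_1+2x_2+\cdots+kx_k=n$. Its characteristic function is $\mathbb{E}[e^{iuN^k(t)}]=e^{-\lambda t(k-\sum_{j=1}^k e^{iuj})}$. Here $\delta_j$ is the Dirac delta concentrated at $j$. *)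

(* Defs.v *)
From HB Require Import structures.
From mathcomp Require Import all_boot all_order all_algebra.
From mathcomp Require Import complex.
From mathcomp Require Import all_classical all_reals all_analysis.
From mathcomp Require Import measurable_realfun.

Set Implicit Arguments.
Unset Strict Implicit.
Unset Printing Implicit Defensive.

Import Order.TTheory GRing.Theory Num.Theory.
Import numFieldNormedType.Exports.

Local Open Scope classical_set_scope.
Local Open Scope ring_scope.
Local Open Scope complex_scope.

Section complex_valued.
Context {R : realType}.

Definition cexp (z : R[i]) : R[i] :=
  (expR (complex.Re z) * cos (complex.Im z)) +i*
  (expR (complex.Re z) * sin (complex.Im z)).

Definition Cintegral d (T : measurableType d) (mu : {measure set T -> \bar R})
    (f : T -> R[i]) : R[i] :=
  Rintegral mu setT (fun x => complex.Re (f x)) +i*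
  Rintegral mu setT (fun x => complex.Im (f x)).

End complex_valued.

Definition Omega (k n : nat) : set (k.-tuple nat) :=
  [set x | (\sum_(j < k) j.+1 * tnth x j)%N = n].
Arguments Omega : clear implicits.

Section processes.
Context {d : measure_display} {T : measurableType d} {R : realType}.
Variable P : probability T R.

(* A process (X_t)_{t >= 0} is a family indexed by R of which only the
   members with t >= 0 are ever constrained or used. *)
Definition process := R -> {RV P >-> R}.

Definition charfun (X : {RV P >-> R}) (u : R) : R[i] :=
  Cintegral P (fun w => cexp (0 +i* (u * X w))).

Definition increment (X : process) (s t : R) : T -> R := fun w => X t w - X s w.

(* Each A i may be taken to be setT, so every subfamily of increments also
   satisfies the product rule. *)
Definition independent_increments (X : process) : Prop :=
  forall (n : nat) (t : nat -> R),
    0 <= t 0%N -> {homo t : i j / (i <= j)%N >-> i <= j} ->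
  forall A : 'I_n -> set R, (forall i, measurable (A i)) ->
    P (\bigcap_(i in [set: 'I_n]) (increment X (t i) (t i.+1) @^-1` A i)) =
    (\prod_(i < n) P (increment X (t i) (t i.+1) @^-1` A i))%E.

Definition stationary_increments (X : process) : Prop :=
  forall (s t : R), 0 <= s -> s <= t ->
  forall A : set R, measurable A ->
    P (increment X s t @^-1` A) = P (increment X 0 (t - s) @^-1` A).

Definition stochastically_continuous (X : process) : Prop :=
  forall (s e : R), 0 <= s -> 0 < e ->
    P [set w | e < `|increment X s t w|] @[t --> within [set r | 0 <= r] (nbhs s)]
    --> 0%E.

Definition levy_process (X : process) : Prop :=
  [/\ {ae P, forall w, X 0 w = 0},
      independent_increments X,
      stationary_increments X &
      stochastically_continuous X].

Definition sigma_process (X : process) : set (set T) :=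
  <<s [set X t @^-1` A | t in [set r | 0 <= r] & A in @measurable _ R] >>.

Definition independent_processes (X Y : process) : Prop :=
  forall A B, sigma_process X A -> sigma_process Y B ->
    P (A `&` B) = (P A * P B)%E.

Definition poisson_order_pmf (k : nat) (lambda t : R) (n : nat) : \bar R :=
  (\esum_(x in Omega k n)
     (expR (- (k%:R * lambda * t)) *
      ((lambda * t) ^+ (\sum_(j < k) tnth x j) /
       (\prod_(j < k) (tnth x j)`!)%:R))%:E)%E.

Definition poisson_process_order (k : nat) (lambda : R) (N : process) : Prop :=
  levy_process N /\
  forall t, 0 <= t -> forall n : nat,
    P [set w | N t w = n%:R] = poisson_order_pmf k lambda t n.

Definition diff_process (X Y : process) : process :=
  fun t => (X t : {mfun T >-> R}) - (Y t : {mfun T >-> R}).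

Definition levy_integrable (nu : {measure set R -> \bar R}) : Prop :=
  nu [set 0] = 0%E /\
  (\int[nu]_x (Order.min 1 (x ^+ 2))%:E < +oo)%E.

(* Exponent of the Levy-Khintchine formula for the triplet (b, a, nu), where a
   is the Gaussian variance and jumps are compensated on `|x| <= 1. *)
Definition levy_exponent (b a : R) (nu : {measure set R -> \bar R}) (u : R)
    : R[i] :=
  0 +i* (b * u) - (a * u ^+ 2 / 2)%:C +
  Cintegral nu (fun x => cexp (0 +i* (u * x)) - 1
                         - 0 +i* (u * x * \1_[set y : R | `|y| <= 1] x)).

(* nu is determined by X, by uniqueness of the Levy-Khintchine triplet. *)
Definition is_levy_measure (X : process) (nu : {measure set R -> \bar R})
    : Prop :=
  [/\ levy_process X, levy_integrable nu &
      exists b a : R, 0 <= a /\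
        forall t u : R, 0 <= t ->
          charfun (X t) u = cexp (t%:C * levy_exponent b a nu u)].

End processes.

(* Main.v *)
Require Import Defs.
From mathcomp Require Import all_boot all_order all_algebra.
From mathcomp Require Import ring lra.
From mathcomp Require Import complex.
From mathcomp Require Import all_classical all_reals all_analysis.
From mathcomp Require Import measurable_realfun.

(** The difference [S] of two independent processes of order [k] is a Levy
    process because each defining property passes to differences of
    independent processes, and its Levy measure is read off an explicit
    characteristic function.

    Characteristic functions are handled through the real identities
      [E (1 + cos (x + u X)) = 1 + rho cos (x + phi)] for every phase [x],
    which say that [X] has characteristic function [rho e^(i phi)] at [u].
    The integrand is nonnegative, so series, double series and iterated
    integrals can be rearranged freely, with no summability bookkeeping; and
    the right-hand side is again of the form [(1 - rho) + rho (1 + cos y)], so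
    that such identities compose when independent terms are added.

    For one Poisson variable the identity is the expansion of
    [e^(s cos u) cos (x + s sin u)], the real part of [e^(ix) e^(s e^(iu))], in
    powers of [s] ([cvg_twist_jet]).  Peeling off one coordinate of the
    summation tuple at a time gives the law of order [k]
    ([esum_tuple_weight], [expectation_cos_poisson_order]): it is the law of
    [x_1 + 2 x_2 + ... + k x_k] with independent Poisson [x_j].  Tonelli for
    the joint law of the two processes then gives the law of [S]
    ([expectation_cos_skellam]), with
      [ln rho + i phi = t * (lambda1 * sum_j (e^(iuj) - 1)
                             + lambda2 * sum_j (e^(-iuj) - 1))],
    which is [t] times the integral of [e^(iux) - 1] against the measure
    claimed.  That measure is finite, so the compensator of small jumps is
    a pure drift, absorbed in the constant [b] of the triplet, and the Gaussian
    part is [0].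

    The joint law of independent random variables, and of finitely many pairs
    of increments, is determined by its values on rectangles
    ([eq_measure_rectangles], [product_rule_rectangles]); this gives both
    the use of Tonelli and the independence and stationarity of the increments
    of [S]. *)

Set Implicit Arguments.
Unset Strict Implicit.
Unset Printing Implicit Defensive.

Import Order.TTheory GRing.Theory Num.Theory.
Import numFieldNormedType.Exports.

Local Open Scope classical_set_scope.
Local Open Scope ring_scope.

(** * Expansion of a Poisson characteristic function *)

Section taylor.
Context {R : realType}.
Implicit Types (x u s a : R).

(** The real part of [e^(ix) * exp (s * e^(iu))]. *)
Definition twist u x s : R := expR (s * cos u) * cos (x + s * sin u).

(** The real part of [e^(ix)] times a partial sum of [exp (s * e^(iu))]. *)
Definition twist_jet u x n s : R :=
  \sum_(m < n) s ^+ m / m`!%:R * cos (x + m%:R * u).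

(** Differentiating [exp (s * e^(iu))] multiplies it by [e^(iu)], that is, adds
    [u] to the phase. *)
Lemma is_derive_twist u x s : is_derive s 1 (twist u x) (twist u (x + u) s).
Proof.
apply: (@is_derive_eq R _ _
  (fun s => expR (s * cos u) * cos (x + s * sin u)) s 1).
by rewrite /GRing.scale/= /twist addrAC [in RHS]cosD; ring.
Qed.

Lemma is_derive_scale_exp (f : R -> R) a n s : (forall y, f y = a * y ^+ n) ->
  is_derive s 1 f (a * (n%:R * s ^+ n.-1)).
Proof.
move=> fE; have -> : f = a *: ((@id R) ^+ n).
  by apply/funext => y; rewrite fE exprfctE.
by apply: is_derive_eq; rewrite /GRing.scale/= mulr1.
Qed.

Lemma is_derive_twist_jet u x n s :
  is_derive s 1 (twist_jet u x n.+1) (twist_jet u (x + u) n s).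
Proof.
have -> : twist_jet u x n.+1 =
  (\sum_(m < n.+1) (fun s => s ^+ m / m`!%:R * cos (x + m%:R * u))).
  by apply/funext => y; rewrite /twist_jet fct_sumE.
have H (m : 'I_n.+1) :
   is_derive s 1 (fun s : R => s ^+ m / m`!%:R * cos (x + m%:R * u))
   (m%:R * s ^+ m.-1 / m`!%:R * cos (x + m%:R * u)).
  have -> : m%:R * s ^+ m.-1 / m`!%:R * cos (x + m%:R * u) =
      cos (x + m%:R * u) / m`!%:R * (m%:R * s ^+ m.-1) by ring.
  apply: is_derive_scale_exp => y; ring.
apply: (is_derive_eq (is_derive_sum H)).
rewrite big_ord_recl/= !mul0r add0r; apply: eq_bigr => i _.
rewrite /= /bump add1n factS natrM -natr1.
have := fact_gt0 i.
rewrite -(ltr_nat R) => f0.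
have -> : x + u + i%:R * u = x + (i%:R + 1) * u by ring.
by field; rewrite lt0r_neq0//= natr1 pnatr_eq0.
Qed.

Lemma ge0_derive_ge0 (g dg : R -> R) S :
  g 0 = 0 -> (forall s, is_derive s 1 g (dg s)) ->
  (forall s, 0 <= s <= S -> 0 <= dg s) -> forall s, 0 <= s <= S -> 0 <= g s.
Proof.
move=> g0 hg dg0 s /andP[s0 sS]; rewrite -g0.
apply: (@ger0_derive1_ndecr _ g 0 S) => //.
- move=> y; rewrite in_itv/= => /andP[y0 yS].
  by rewrite derive1E (@derive_val _ _ _ _ _ _ _ (hg y)) dg0// !ltW.
- by apply: derivable_within_continuous => y _;
    exact: (@ex_derive _ _ _ _ _ _ _ (hg y)).
Qed.

(** Both sides of the difference obey the same differentiation rule, so the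
    bound at order [n + 1] follows from the bound at order [n], for the phase
    [x + u], by comparing derivatives on [0, S]; at order [0] it is
    [e^(s cos u) <= e^S]. *)
Lemma twist_remainder u x n S s : 0 <= s <= S ->
  `|twist u x s - twist_jet u x n s| <= expR S * (s ^+ n / n`!%:R).
Proof.
elim: n x s => [|n IH] x s sS.
  rewrite /twist_jet big_ord0 subr0 /twist normrM expr0 fact0 invr1 mulr1.
  rewrite ger0_norm ?expR_ge0//; apply: ler_pM; rewrite ?expR_ge0//.
    rewrite ler_expR; case/andP: sS => s0 sS.
    by rewrite (le_trans _ sS)// ler_piMr// cos_le1.
  by rewrite ler_norml cos_geN1 cos_le1.
have fn (m : nat) : m`!%:R != 0 :> R by rewrite pnatr_eq0 -lt0n fact_gt0.
have dp (y : R) : is_derive y 1 (fun s => expR S * (s ^+ n.+1 / n.+1`!%:R))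
    (expR S * (y ^+ n / n`!%:R)).
  have -> : expR S * (y ^+ n / n`!%:R) =
      expR S / n.+1`!%:R * (n.+1%:R * y ^+ n.+1.-1).
    by rewrite factS natrM; field; rewrite fn /= nat1r pnatr_eq0.
  by apply: is_derive_scale_exp => z; ring.
have dt (y : R) : is_derive y 1 (fun s => twist u x s - twist_jet u x n.+1 s)
    (twist u (x + u) y - twist_jet u (x + u) n y).
  by apply: is_deriveB; [exact: is_derive_twist|exact: is_derive_twist_jet].
have t0 : twist u x 0 - twist_jet u x n.+1 0 = 0.
  rewrite /twist /twist_jet !mul0r expR0 mul1r addr0 big_ord_recl big1 => [|i _].
    by rewrite fact0 mul0r addr0 expr0 invr1 !mul1r addr0 subrr.
  by rewrite expr0n/= !mul0r.
rewrite ler_norml; apply/andP; split.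
- rewrite -subr_ge0 opprK.
  apply: (@ge0_derive_ge0 (fun s => twist u x s - twist_jet u x n.+1 s +
     expR S * (s ^+ n.+1 / n.+1`!%:R))) sS => //=.
    by rewrite t0 expr0n/= mul0r mulr0 ?subr0 ?addr0.
  move=> y /(IH (x + u)); rewrite ler_norml => /andP[+ _].
  by rewrite -subr_ge0 opprK.
- rewrite -subr_ge0.
  apply: (@ge0_derive_ge0 (fun s => expR S * (s ^+ n.+1 / n.+1`!%:R) -
     (twist u x s - twist_jet u x n.+1 s))) sS => //=.
    by rewrite t0 expr0n/= mul0r mulr0 ?subr0 ?addr0.
  move=> y /(IH (x + u)); rewrite ler_norml => /andP[_].
  by rewrite -subr_ge0.
Qed.

Lemma cvg_twist_jet u x s : 0 <= s ->
  twist_jet u x n s @[n --> \oo] --> twist u x s.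
Proof.
move=> s0; apply/cvgrPdist_le => e e0.
have /cvgrPdist_le/(_ e e0) : (fun n => expR s * exp_coeff s n) @ \oo --> (0 : R).
  rewrite -[X in _ --> X](mulr0 (expR s)); apply: cvgMr; exact: cvg_exp_coeff.
apply: filterS => n; rewrite sub0r normrN => h.
apply: le_trans h; apply: (le_trans (@twist_remainder u x n s s _)).
  by rewrite s0 lexx.
exact: ler_norm.
Qed.
End taylor.

(** * Sums over tuples with Poisson weights *)

Lemma esumZl (R : realType) (T : choiceType) (D : set T) (r : R)
    (f : T -> \bar R) : 0 <= r -> (forall i, 0 <= f i)%E ->
  (\esum_(i in D) (r%:E * f i) = r%:E * \esum_(i in D) f i)%E.
Proof.
move=> r0 f0; rewrite /esum -ereal_supZl//; last first.
  by apply/set0P; exists (\sum_(i \in set0) f i)%E; exists set0 => //;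
    exact: fsets_set0.
congr ereal_sup; apply/seteqP; split => x /=.
  move=> [A hA <-]; exists (\sum_(i \in A) f i)%E; first by exists A.
  by rewrite ge0_mule_fsumr.
by move=> [_ [A hA <-] <-]; exists A => //; rewrite ge0_mule_fsumr.
Qed.

Section poisson_series.
Context {R : realType}.
Implicit Types (x u a rho mu : R).

Lemma cos1_ge0 rho x : 0 <= rho <= 1 -> 0 <= 1 + rho * cos x.
Proof.
move=> /andP[r0 r1]; have := cos_geN1 x; have := cos_le1 x; nra.
Qed.

Lemma cos1p_ge0 x : 0 <= 1 + cos x.
Proof. by rewrite -[cos x]mul1r cos1_ge0// ler01 lexx. Qed.

(** The factor [rho] lets this identity absorb the modulus produced by the
    coordinates already summed. *)
Lemma esum_poisson a rho mu u x : 0 <= a -> 0 <= rho <= 1 -> 0 <= mu ->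
  \esum_(m in [set: nat])
    (a * (mu ^+ m / m`!%:R * (1 + rho * cos (x + m%:R * u))))%:E =
  (a * (expR mu + rho * twist u x mu))%:E.
Proof.
move=> a0 r01 mu0.
rewrite -nneseries_esumT; last first.
  by move=> m; rewrite lee_fin !mulr_ge0 ?invr_ge0 ?exprn_ge0 ?cos1_ge0.
apply/cvg_lim => //.
have -> : (fun n => \sum_(0 <= m < n)
    (a * (mu ^+ m / m`!%:R * (1 + rho * cos (x + m%:R * u))))%:E)%E =
  EFin \o (fun n => a * (twist_jet 0 0 n mu + rho * twist_jet u x n mu)).
  apply/funext => n /=; rewrite sumEFin big_mkord; congr EFin.
  rewrite /twist_jet (mulr_sumr _ _ _ rho) -big_split/= mulr_sumr.
  by apply: eq_bigr => i _; rewrite mulr0 addr0 cos0; ring.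
apply/cvg_EFin; first by near=> n.
have -> : expR mu = twist 0 0 mu.
  by rewrite /twist cos0 sin0 mulr1 mulr0 addr0 cos0 mulr1.
by apply: cvgMr; apply: cvgD; [|apply: cvgMr]; exact: cvg_twist_jet.
Unshelve. all: by end_near. Qed.

(** The product over the coordinates of the unnormalised Poisson weights. *)
Definition tuple_weight mu k (y : k.-tuple nat) : R :=
  mu ^+ (\sum_(j < k) tnth y j) / (\prod_(j < k) (tnth y j)`!)%:R.

Lemma tuple_weight_ge0 mu k (y : k.-tuple nat) :
  0 <= mu -> 0 <= tuple_weight mu y.
Proof. by move=> mu0; rewrite divr_ge0 ?exprn_ge0. Qed.

Lemma tuple_weight_cons mu k m (y : k.-tuple nat) :
  tuple_weight mu [tuple of m :: y] = mu ^+ m / m`!%:R * tuple_weight mu y.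
Proof.
rewrite /tuple_weight !big_ord_recl !tnth0.
under eq_bigr do rewrite tnthS.
under [in X in _ / (_ * X)%:R]eq_bigr do rewrite tnthS.
by rewrite exprD natrM invfM; ring.
Qed.

Lemma cons_tuple_bij k :
  set_bij ([set: nat] `*`` (fun=> [set: k.-tuple nat])) [set: k.+1.-tuple nat]
  (fun p => [tuple of p.1 :: p.2]).
Proof.
split => //.
- by move=> [m y] [m' y'] _ _ /= h; have /= := congr1 val h => -[-> /val_inj ->].
- move=> y _; exists (thead y, [tuple of behead y]) => //=.
  by rewrite [RHS]tuple_eta.
Qed.

(** Summing over all coordinates but the first, for the phase [x + m c_0 u],
    leaves a one-variable Poisson sum over the first coordinate [m].  The
    weights [c] are arbitrary and [a] is carried along so that this induction
    goes through. *)
Lemma esum_tuple_weight mu u k (c : nat -> nat) a x : 0 <= a -> 0 <= mu ->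
  \esum_(y in [set: k.-tuple nat])
    (a * (tuple_weight mu y *
      (1 + cos (x + (\sum_(j < k) c j * tnth y j)%:R * u))))%:E =
  (a * (expR (k%:R * mu) + expR (\sum_(j < k) mu * cos ((c j)%:R * u)) *
     cos (x + \sum_(j < k) mu * sin ((c j)%:R * u))))%:E.
Proof.
elim: k c a x => [|k IH] c a x a0 mu0.
  have -> : [set: 0.-tuple nat] = [set [tuple]].
    by apply/seteqP; split => // y _; rewrite /= [y]tuple0.
  rewrite esum_set1 /tuple_weight !big_ord0 ?mul0r ?expr0 ?invr1 ?mul1r
    ?addr0 ?expR0 ?mul1r//.
  by rewrite lee_fin mulr_ge0// cos1p_ge0.
rewrite (reindex_esum _ _ _ _ (cons_tuple_bij k)).
rewrite -(@esum_esum _ _ _ _ (fun=> [set: k.-tuple nat])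
  (fun m y => (a * (tuple_weight mu [tuple of m :: y] * (1 + cos (x +
    (\sum_(j < k.+1) c j * tnth [tuple of m :: y] j)%:R * u))))%:E)); last first.
  move=> m y _ _; rewrite lee_fin; apply: mulr_ge0 => //.
  by apply: mulr_ge0; [exact: tuple_weight_ge0|exact: cos1p_ge0].
set E := expR (k%:R * mu); set C := \sum_(j < k) mu * cos ((c j.+1)%:R * u).
set S := \sum_(j < k) mu * sin ((c j.+1)%:R * u).
have CE : expR C <= E.
  rewrite ler_expR mulr_natl -[k in _ *+ k]card_ord -sumr_const.
  by apply: ler_sum => j _; rewrite ler_piMr// cos_le1.
have E0 : 0 < E by exact: expR_gt0.
(* [expR C / E], at most 1, is the modulus of the sum over the tail. *)
transitivity (\esum_(m in [set: nat]) (a * E * (mu ^+ m / m`!%:R *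
    (1 + (expR C / E) * cos ((x + S) + m%:R * ((c 0%N)%:R * u)))))%:E).
  apply: eq_esum => m _.
  transitivity (\esum_(y in [set: k.-tuple nat])
    (a * (mu ^+ m / m`!%:R) * (tuple_weight mu y *
      (1 + cos (x + m%:R * ((c 0%N)%:R * u) +
        (\sum_(j < k) c j.+1 * tnth y j)%:R * u))))%:E).
    apply: eq_esum => y _; rewrite tuple_weight_cons big_ord_recl tnth0.
    under eq_bigr => j _ do rewrite tnthS (_ : c (lift ord0 j) = c j.+1)//.
    rewrite natrD natrM; congr EFin.
    have -> : x + ((c 0%N)%:R * m%:R +
        (\sum_(j < k) c j.+1 * tnth y j)%:R) * u =
      x + m%:R * ((c 0%N)%:R * u) + (\sum_(j < k) c j.+1 * tnth y j)%:R * u.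
      by ring.
    by ring.
  rewrite (IH (fun j => c j.+1)) ?mulr_ge0 ?invr_ge0 ?exprn_ge0// -/E -/C -/S.
  congr EFin; rewrite [x + S + _]addrAC; field.
  by rewrite pnatr_eq0 -lt0n fact_gt0 lt0r_neq0.
have r01 : 0 <= expR C / E <= 1.
  by rewrite divr_ge0 ?expR_ge0 ?(ltW E0)//= ler_pdivrMr// mul1r.
rewrite (esum_poisson _ _ (mulr_ge0 a0 (ltW E0)) r01 mu0).
have -> : \sum_(j < k.+1) mu * cos ((c j)%:R * u) =
    mu * cos ((c 0%N)%:R * u) + C by rewrite big_ord_recl.
have -> : \sum_(j < k.+1) mu * sin ((c j)%:R * u) =
    mu * sin ((c 0%N)%:R * u) + S by rewrite big_ord_recl.
rewrite /twist expRD.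
have -> : k.+1%:R * mu = k%:R * mu + mu by rewrite -natr1; ring.
rewrite expRD -/E [x + (_ + S)]addrA [x + S + _]addrAC; congr EFin; field.
exact: lt0r_neq0.
Qed.
End poisson_series.

(** * Law of the Poisson process of order [k] *)

Section poisson_order_law.
Context {R : realType}.
Implicit Types (x u lambda t : R).

(** Modulus and argument of the characteristic function at [u] of the process
    at time [t], [exp (lambda * t * sum_j (e^(iuj) - 1))]. *)
Definition poisson_modulus k lambda t u : R :=
  expR (\sum_(j < k) lambda * t * (cos (j.+1%:R * u) - 1)).

Definition poisson_phase k lambda t u : R :=
  \sum_(j < k) lambda * t * sin (j.+1%:R * u).

Lemma Omega_bij k : set_bij ([set: nat] `*`` Omega k) [set: k.-tuple nat] snd.
Proof.
split => //.
- by move=> [n y] [n' y'] /= /set_mem/= [_ <-] /set_mem/= [_ <-] ->.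
- by move=> y _; exists ((\sum_(j < k) j.+1 * tnth y j)%N, y).
Qed.

Lemma poisson_order_pmf_ge0 k lambda t n : 0 <= lambda * t ->
  (0 <= poisson_order_pmf k lambda t n)%E.
Proof.
move=> lt0; apply: esum_ge0 => y _; rewrite lee_fin mulr_ge0 ?expR_ge0//.
exact: tuple_weight_ge0.
Qed.

(** The fibers [Omega k n] partition the tuples, so that the sum over [n] is a
    sum over all tuples. *)
Lemma poisson_order_pmf_cos k lambda t u x : 0 <= lambda * t ->
  (\sum_(0 <= n <oo) (1 + cos (x + n%:R * u))%:E *
     poisson_order_pmf k lambda t n =
  (1 + poisson_modulus k lambda t u * cos (x + poisson_phase k lambda t u))%:E)%E.
Proof.
move=> lt0; set mu := lambda * t in lt0 *; set e := expR (- (k%:R * lambda * t)).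
rewrite nneseries_esumT => [|n]; last first.
  by rewrite mule_ge0 ?lee_fin ?cos1p_ge0// poisson_order_pmf_ge0.
transitivity (\esum_(n in [set: nat]) \esum_(y in Omega k n)
    (e * (tuple_weight mu y * (1 + cos (x + n%:R * u))))%:E).
  apply: eq_esum => n _; rewrite /poisson_order_pmf -esumZl ?cos1p_ge0//.
    apply: eq_esum => y _; rewrite -EFinM; congr EFin.
    by rewrite -/e -/mu -/(tuple_weight mu y); ring.
  move=> y; rewrite lee_fin mulr_ge0 ?expR_ge0//; exact: tuple_weight_ge0.
rewrite esum_esum => [|n y _ _]; last first.
  rewrite lee_fin; apply: mulr_ge0; rewrite ?expR_ge0//.
  by apply: mulr_ge0; [exact: tuple_weight_ge0|exact: cos1p_ge0].
transitivity (\esum_(p in [set: nat] `*`` Omega k)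
    (e * (tuple_weight mu p.2 *
      (1 + cos (x + (\sum_(j < k) j.+1 * tnth p.2 j)%:R * u))))%:E).
  by apply: eq_esum => -[n y] /= [_ ->].
rewrite -(reindex_esum _ _ _ (fun y => (e * (tuple_weight mu y *
   (1 + cos (x + (\sum_(j < k) j.+1 * tnth y j)%:R * u))))%:E) (@Omega_bij k)).
rewrite (@esum_tuple_weight _ mu u k S) ?expR_ge0//.
have eE : e * expR (k%:R * mu) = 1.
  by rewrite -expRD /mu mulrA addNr expR0.
rewrite mulrDr eE mulrA; congr (1 + _ * _)%:E.
rewrite -expRD; congr expR.
under [RHS]eq_bigr do rewrite mulrBr mulr1.
rewrite sumrB sumr_const card_ord -mulr_natl /mu; ring.
Qed.

(** The previous identity at [u = x = 0] gives twice the total mass. *)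
Lemma poisson_order_pmf_mass k lambda t : 0 <= lambda * t ->
  (\sum_(0 <= n <oo) poisson_order_pmf k lambda t n = 1)%E.
Proof.
move=> lt0; have := @poisson_order_pmf_cos k lambda t 0 0 lt0.
under eq_eseriesr do rewrite mulr0 addr0 cos0.
rewrite nneseriesZl => [|n _]; last exact: poisson_order_pmf_ge0.
rewrite /poisson_modulus /poisson_phase big1 => [|j _]; last first.
  by rewrite mulr0 cos0 subrr mulr0.
rewrite big1 => [|j _]; last by rewrite mulr0 sin0 mulr0.
rewrite expR0 addr0 cos0 mulr1.
have : (0 <= \sum_(0 <= n <oo) poisson_order_pmf k lambda t n)%E.
  by apply: nneseries_ge0 => n _ _; exact: poisson_order_pmf_ge0.
case: (\sum_(0 <= n <oo) _)%E => [r| |]//=.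
  by rewrite -EFinM => _ [] h; congr EFin; lra.
by rewrite gt0_muley// lte_fin.
Qed.

Lemma measurable_fun_cos : measurable_fun setT (@cos R).
Proof. by apply: continuous_measurable_fun; exact: continuous_cos. Qed.

Lemma measurable_cos1p (a u : R) :
  measurable_fun setT (fun r : R => 1 + cos (a + u * r)).
Proof.
apply: measurable_funD => //.
apply: (measurableT_comp measurable_fun_cos).
by apply: measurable_funD => //; exact: measurable_funM.
Qed.

(** Since the masses at the naturals add up to [1], the variable is almost
    surely a natural number and the integral splits over its values. *)
Lemma integral_natural_rv d (T : measurableType d) (P : probability T R)
    (X : {RV P >-> R}) (g : R -> R) :
  (\sum_(0 <= n <oo) P [set w | X w = n%:R] = 1)%E ->
  measurable_fun setT g -> (forall r, 0 <= g r) ->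
  (\int[P]_w (g (X w))%:E =
   \sum_(0 <= n <oo) (g n%:R)%:E * P [set w | X w = n%:R])%E.
Proof.
move=> X1 mg g0.
pose F n := [set w | X w = n%:R :> R].
have mF n : measurable (F n).
  have -> : F n = X @^-1` [set n%:R] by [].
  by rewrite -[X in measurable X]setTI; exact: measurable_funPT.
have tF : trivIset setT F.
  apply/trivIsetP => i j _ _ ij; apply/seteqP; split => w //= -[].
  rewrite /F/= => -> /eqP.
  by rewrite eqr_nat (negPf ij).
have mgX : measurable_fun setT (fun w => (g (X w))%:E).
  by apply/measurable_EFinP; exact: measurableT_comp.
have PF : P (\bigcup_n F n) = 1%E.
  rewrite measure_bigcup//= -X1; apply: eq_eseriesl => n. by rewrite in_setT.
have mU : measurable (\bigcup_n F n) by exact: bigcup_measurable.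
have PN : P (~` \bigcup_n F n) = 0%E by rewrite probability_setC// PF subee.
rewrite (@ge0_negligible_integral _ _ _ _ _ (~` \bigcup_n F n))//; last 2 first.
- exact: measurableC.
- by move=> w _; rewrite lee_fin.
rewrite setTD setCK ge0_integral_bigcup//; last 2 first.
- exact: measurable_funTS.
- by move=> w _; rewrite lee_fin.
apply: eq_eseriesr => n _.
rewrite (eq_integral (cst (g n%:R)%:E)) ?integral_cst// => w.
by rewrite inE /F/= => ->.
Qed.

Lemma expectation_cos_poisson_order d (T : measurableType d)
    (P : probability T R) k lambda (N : process P) t u x : 0 < lambda ->
  poisson_process_order k lambda N -> 0 <= t ->
  (\int[P]_w (1 + cos (x + u * N t w))%:E =
   (1 + poisson_modulus k lambda t u * cos (x + poisson_phase k lambda t u))%:E)%E.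
Proof.
move=> l0 [_ hN] t0; have lt0 : 0 <= lambda * t by rewrite mulr_ge0// ltW.
rewrite (@integral_natural_rv _ _ _ (N t) (fun r => 1 + cos (x + u * r))).
- rewrite -poisson_order_pmf_cos//; apply: eq_eseriesr => n _.
  by rewrite hN// [u * _]mulrC.
- by rewrite -(poisson_order_pmf_mass k lt0); apply: eq_eseriesr => n _; rewrite hN.
- exact: measurable_cos1p.
- move=> r; exact: cos1p_ge0.
Qed.
End poisson_order_law.

(** * Joint laws of independent variables *)

Lemma eq_measure_rectangles d1 d2 (T1 : measurableType d1)
    (T2 : measurableType d2) (R : realType)
    (m1 m2 : {measure set (T1 * T2) -> \bar R}) :
  (m1 setT < +oo)%E ->
  (forall A B, measurable A -> measurable B -> m1 (A `*` B) = m2 (A `*` B)) ->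
  forall E, measurable E -> m1 E = m2 E.
Proof.
move=> fin m12 E mE.
apply: (measure_unique [set A `*` B | A in measurable & B in measurable]
  (fun=> setT)) => //.
- exact: measurable_prod_measurableType.
- move=> _ _ [A mA [B mB <-]] [A' mA' [B' mB' <-]]; rewrite -setXI.
  by exists (A `&` A'); [exact: measurableI|exists (B `&` B'); [exact: measurableI|]].
- by move=> _; exists setT => //; exists setT => //; rewrite setXTT.
- by rewrite bigcup_const.
- by move=> _ [A mA [B mB <-]]; exact: m12.
Qed.

Section independent_pair.
Context d (T : measurableType d) (R : realType) (P : probability T R).
Implicit Types X Y : {RV P >-> R}.

Lemma integral_independent_pair X Y (f : R * R -> \bar R) :
  (forall A B, measurable A -> measurable B ->
    P (X @^-1` A `&` Y @^-1` B) = (P (X @^-1` A) * P (Y @^-1` B))%E) ->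
  measurable_fun setT f -> (forall z, 0 <= f z)%E ->
  (\int[P]_w f (X w, Y w) = \int[P]_w \int[P]_w' f (X w, Y w'))%E.
Proof.
move=> XY mf f0.
have mXY : measurable_fun setT (fun w => (X w, Y w)) by exact: measurable_fun_pair.
pose m := pushforward P (fun w => (X w, Y w)).
transitivity (\int[m]_z f z)%E.
  by rewrite ge0_integral_pushforward.
transitivity (\int[distribution P X \x distribution P Y]_z f z)%E.
  apply: eq_measure_integral => E mE _; apply/esym.
  by apply: product_measure_unique => // A B mA mB; exact: XY.
rewrite fubini_tonelli1//=.
have mF := @measurable_fun_fubini_tonelli_F _ _ _ _ _ (distribution P Y) f mf f0.
rewrite ge0_integral_distribution//=; last by move=> x; exact: integral_ge0.
apply: eq_integral => w _ /=; rewrite /fubini_F ge0_integral_distribution//=.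
exact: measurableT_comp.
Qed.
(** The phases [x = 0] and [x = - pi / 2] give the real and imaginary parts. *)
Lemma charfun_of_cos X (u rho phi : R) :
  (forall x, \int[P]_w (1 + cos (x + u * X w))%:E =
     (1 + rho * cos (x + phi))%:E)%E ->
  charfun X u = ((rho * cos phi) +i* (rho * sin phi))%C.
Proof.
move=> h.
have mc x : measurable_fun setT (fun w => 1 + cos (x + u * X w)).
  exact: (measurableT_comp (measurable_cos1p x u)).
have ic x : P.-integrable setT (fun w => (1 + cos (x + u * X w))%:E).
  apply/integrableP; split; first exact/measurable_EFinP.
  under eq_integral do rewrite gee0_abs ?lee_fin ?cos1p_ge0//.
  by rewrite h ltry.
have i1 : P.-integrable setT (fun w : T => (1 : R)%:E).
  exact: finite_measure_integrable_cst.
have hR x : Rintegral P setT (fun w => cos (x + u * X w)) = rho * cos (x + phi).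
  have := RintegralB measurableT (ic x) i1.
  rewrite {2}/Rintegral h /= Rintegral_cst//.
  rewrite (_ : fine _ = 1) ?mulr1; last exact: (congr1 fine (@probability_setT _ _ _ P)).
  rewrite addrAC subrr add0r => <-.
  by apply: eq_Rintegral => w _; rewrite /=; ring.
have sE (y : R) : sin y = cos (- (pi / 2) + y).
  by rewrite addrC cosB cos_pihalf sin_pihalf mulr0 mulr1 add0r.
rewrite /charfun /Cintegral /=; congr (_ +i* _)%C.
  rewrite -[phi]add0r -hR; apply: eq_Rintegral => w _.
  by rewrite expR0 mul1r add0r.
rewrite sE -hR; apply: eq_Rintegral => w _.
by rewrite expR0 mul1r sE.
Qed.
End independent_pair.

(** * Law of the difference process *)

Section skellam_charfun.
Context d (T : measurableType d) (R : realType) (P : probability T R).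

Lemma sigma_process_preimage (X : process P) t A : 0 <= t -> measurable A ->
  sigma_process X (X t @^-1` A).
Proof.
by move=> t0 mA; apply: sub_sigma_algebra; exists t => //; exists A.
Qed.

(** Integrating over [N2] first turns [x + u (N1 - N2)] into the phase
    [x + u N1] shifted by the argument of [N2] at [- u], and scales the cosine
    by its modulus [r2 <= 1]. *)
Lemma expectation_cos_skellam k (l1 l2 : R) (N1 N2 : process P) t u x :
  0 < l1 -> 0 < l2 -> poisson_process_order k l1 N1 ->
  poisson_process_order k l2 N2 -> independent_processes N1 N2 -> 0 <= t ->
  (\int[P]_w (1 + cos (x + u * diff_process N1 N2 t w))%:E =
  (1 + (poisson_modulus k l1 t u * poisson_modulus k l2 t (- u)) *
    cos (x + (poisson_phase k l1 t u + poisson_phase k l2 t (- u))))%:E)%E.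
Proof.
move=> l10 l20 h1 h2 ind t0.
set r1 := poisson_modulus _ _ _ _; set r2 := poisson_modulus _ _ _ _.
set a1 := poisson_phase _ _ _ _; set a2 := poisson_phase _ _ _ _.
have r2_ge0 : 0 <= r2 by exact: expR_ge0.
have r2_le1 : r2 <= 1.
  rewrite /r2 /poisson_modulus -expR0 ler_expR; apply: sumr_le0 => j _.
  by rewrite mulr_ge0_le0 ?mulr_ge0 ?(ltW l20)// subr_le0 cos_le1.
transitivity (\int[P]_w \int[P]_w' (1 + cos (x + u * (N1 t w - N2 t w')))%:E)%E.
  apply: (@integral_independent_pair _ _ _ P (N1 t) (N2 t)
    (fun z => (1 + cos (x + u * (z.1 - z.2)))%:E)).
  - by move=> A B mA mB; apply: ind; exact: sigma_process_preimage.
  - apply/measurable_EFinP; apply: (measurableT_comp (measurable_cos1p x u)).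
    exact: measurable_funB.
  - by move=> z; rewrite lee_fin cos1p_ge0.
transitivity (\int[P]_w ((1 - r2)%:E +
  r2%:E * (1 + cos (x + a2 + u * N1 t w))%:E))%E.
  apply: eq_integral => w _.
  under eq_integral => w' _.
    rewrite (_ : x + u * (N1 t w - N2 t w') =
      (x + u * N1 t w) + (- u) * N2 t w'); last by ring.
    over.
  rewrite (expectation_cos_poisson_order _ _ l20 h2 t0) -/r2 -/a2 -EFinM -EFinD.
  by congr EFin; rewrite [x + _ + a2]addrAC; ring.
have mc := measurableT_comp (measurable_cos1p (x + a2) u) (measurable_funPT (N1 t)).
rewrite ge0_integralD//=; last 3 first.
- by move=> w _; rewrite lee_fin subr_ge0.
- by move=> w _; rewrite -EFinM lee_fin mulr_ge0// cos1p_ge0.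
- by apply: measurable_funeM; exact/measurable_EFinP.
rewrite ge0_integralZl//=; last exact/measurable_EFinP.
rewrite (expectation_cos_poisson_order _ _ l10 h1 t0) -/r1 -/a1.
rewrite integral_cst// [X in (_ * X)%E](@probability_setT _ _ _ P) mule1 -EFinM -EFinD.
by congr EFin; rewrite [a1 + a2]addrC addrA; ring.
Qed.
End skellam_charfun.

(** * Differences of independent Levy processes *)

Section product_rule.
Context d (T : measurableType d) (R : realType) (P : probability T R).
Context d1 d2 (T1 : measurableType d1) (T2 : measurableType d2).

(** Rectangles are replaced by measurable sets one index at a time: with the
    events of the other indices fixed, both sides are finite measures in the
    set [E i0], and they agree on rectangles. *)
Lemma product_rule_rectangles n (Z : 'I_n -> T -> T1 * T2) :
  (forall i, measurable_fun setT (Z i)) ->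
  (forall (A : 'I_n -> set T1) (B : 'I_n -> set T2),
    (forall i, measurable (A i)) -> (forall i, measurable (B i)) ->
    P (\bigcap_(i in [set: 'I_n]) (Z i @^-1` (A i `*` B i))) =
    (\prod_(i < n) P (Z i @^-1` (A i `*` B i)))%E) ->
  forall E : 'I_n -> set (T1 * T2), (forall i, measurable (E i)) ->
    P (\bigcap_(i in [set: 'I_n]) (Z i @^-1` (E i))) =
    (\prod_(i < n) P (Z i @^-1` (E i)))%E.
Proof.
move=> mZ hrect.
have mpre i F : measurable F -> measurable (Z i @^-1` F).
  by move=> mF; rewrite -[X in measurable X]setTI; exact: mZ.
(* [m] counts the indices at which [E] may already be arbitrary. *)
suff H m E : (forall i, measurable (E i)) ->
    (forall i : 'I_n, (m <= i)%N ->
      exists A B, [/\ measurable A, measurable B & E i = A `*` B]) ->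
    P (\bigcap_(i in [set: 'I_n]) (Z i @^-1` (E i))) =
    (\prod_(i < n) P (Z i @^-1` (E i)))%E.
  by move=> E mE; apply: (H n) => // i; rewrite leqNgt ltn_ord.
elim: m E => [|m IH] E mE rE.
  have /choice[A /choice[B AB]] : forall i, exists A B,
      [/\ measurable A, measurable B & E i = A `*` B].
    by move=> i; exact: rE.
  have -> : E = (fun i => A i `*` B i) by apply/funext => i; have [] := AB i.
  by apply: hrect => i; have [] := AB i.
have [nm|mn] := leqP n m.
  by apply: IH => // i mi; have := ltn_ord i; rewrite ltnNge (leq_trans nm mi).
pose i0 := Ordinal mn.
pose upd F i := if i == i0 then F else E i.
pose B := \bigcap_(i in [set i | i != i0]) (Z i @^-1` (E i)).
have mB : measurable B.
  by apply: fin_bigcap_measurable => [|i _]; [exact: finite_finset|exact: mpre].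
have capE F : \bigcap_(i in [set: 'I_n]) (Z i @^-1` upd F i) = Z i0 @^-1` F `&` B.
  apply/seteqP; split => w /=.
    move=> h; split; first by have := h i0 I; rewrite /upd /= eqxx.
    by move=> i /= ii0; have := h i I; rewrite /upd /= (negPf ii0).
  move=> [hF hB] i _; rewrite /upd /=; case: eqVneq => [->//|ii0]; exact: hB.
have prodE F : (\prod_(i < n) P (Z i @^-1` upd F i) =
    P (Z i0 @^-1` F) * \prod_(i < n | i != i0) P (Z i @^-1` E i))%E.
  rewrite (bigD1 i0)//= {1}/upd eqxx; congr (_ * _)%E.
  by apply: eq_bigr => i ii0; rewrite /upd (negPf ii0).
have IHupd F A C : measurable A -> measurable C -> F = A `*` C ->
    P (Z i0 @^-1` F `&` B) =
    (P (Z i0 @^-1` F) * \prod_(i < n | i != i0) P (Z i @^-1` E i))%E.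
  move=> mA mC FE; rewrite -capE -prodE; apply: IH => i.
    by rewrite /upd; case: ifP => // _; rewrite FE; exact: measurableX.
  rewrite /upd; case: eqVneq => [_ _|ii0 mi]; first by exists A, C.
  by apply: rE; rewrite ltn_neqAle mi andbT eq_sym;
    apply: contra ii0 => /eqP h; exact/eqP/val_inj.
(* The whole space is a rectangle: this drops index [i0] from the product. *)
have PB : P B = (\prod_(i < n | i != i0) P (Z i @^-1` E i))%E.
  have := @IHupd setT setT setT measurableT measurableT (esym (@setXTT T1 T2)).
  by rewrite preimage_setT setTI probability_setT mul1e.
have c0 : 0 <= fine (P B) by exact: fine_ge0.
have -> : E = upd (E i0).
  by apply/funext => i; rewrite /upd; case: eqVneq => // ->.
rewrite capE prodE -PB.
pose m1 := pushforward (mrestr P mB) (Z i0).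
pose m2 := pushforward (mscale (NngNum c0) P) (Z i0).
have PBf : (fine (P B))%:E = P B by rewrite fineK// fin_num_measure.
have m2E F : m2 F = (P (Z i0 @^-1` F) * P B)%E by rewrite muleC -PBf.
suff : m1 (E i0) = m2 (E i0) by rewrite m2E.
apply: eq_measure_rectangles => //.
  rewrite /m1 /pushforward /mrestr/= (le_lt_trans (probability_le1 _ _)) ?ltry//.
  by apply: measurableI => //; exact: mpre.
move=> A C mA mC; transitivity (m2 (A `*` C)) => //.
by rewrite m2E PB; exact: (IHupd _ A C).
Qed.
End product_rule.

Section difference_levy.
Context d (T : measurableType d) (R : realType) (P : probability T R).
Implicit Types X Y : process P.

Lemma measurable_increment X s t : measurable_fun setT (increment X s t).
Proof. exact: measurable_funB. Qed.

Lemma increment_diff X Y s t :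
  increment (diff_process X Y) s t =
  (fun w => increment X s t w - increment Y s t w).
Proof.
apply/funext => w; rewrite /increment /diff_process/=.
by change (X t w - Y t w - (X s w - Y s w) =
  X t w - X s w - (Y t w - Y s w)); ring.
Qed.

Lemma sigma_process_increment X s t A : 0 <= s -> 0 <= t -> measurable A ->
  sigma_process X (increment X s t @^-1` A).
Proof.
move=> s0 t0 mA; rewrite /sigma_process; set G := (X in <<s X >>).
have mX r : 0 <= r -> measurable_fun [set: g_sigma_algebraType G] (X r : _ -> R).
  move=> r0 _ B mB; rewrite setTI.
  by apply: sub_sigma_algebra; exists r => //; exists B.
by have := measurable_funB (mX _ t0) (mX _ s0) measurableT mA; rewrite setTI.
Qed.

Lemma sigma_process_bigcap X n (F : 'I_n -> set T) :
  (forall i, sigma_process X (F i)) ->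
  sigma_process X (\bigcap_(i in [set: 'I_n]) F i).
Proof.
rewrite /sigma_process; set G := (X in <<s X >>) => mF.
apply: (@fin_bigcap_measurable _ (g_sigma_algebraType G)) => [|i _];
  by [exact: finite_finset|exact: mF].
Qed.

(** Independence of the processes and of the increments of each of them is the
    product rule for the pairs of increments on rectangles. *)
Lemma independent_increments_diff X Y :
  independent_processes X Y -> independent_increments X ->
  independent_increments Y -> independent_increments (diff_process X Y).
Proof.
move=> XY iX iY n t t0 tinc A mA.
have tn i : 0 <= t i by rewrite (le_trans t0)// tinc.
pose Z (i : 'I_n) w :=
  (increment X (t i) (t i.+1) w, increment Y (t i) (t i.+1) w).
pose E (i : 'I_n) := (fun z : R * R => z.1 - z.2) @^-1` A i.
have DE (i : 'I_n) : increment (diff_process X Y) (t i) (t i.+1) @^-1` A i =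
    Z i @^-1` E i by rewrite increment_diff.
have -> : \bigcap_(i in [set: 'I_n])
    (increment (diff_process X Y) (t i) (t i.+1) @^-1` A i) =
   \bigcap_(i in [set: 'I_n]) (Z i @^-1` E i).
  by apply: eq_bigcapr => i _; exact: DE.
under [RHS]eq_bigr do rewrite DE.
have hZ (C D : set R) i : Z i @^-1` (C `*` D) =
    increment X (t i) (t i.+1) @^-1` C `&` increment Y (t i) (t i.+1) @^-1` D by [].
apply: product_rule_rectangles.
- by move=> i; apply: measurable_fun_pair; exact: measurable_increment.
- move=> C D mC mD.
  under eq_bigcapr do rewrite hZ.
  rewrite bigcapI XY; last 2 first.
  + by apply: sigma_process_bigcap => i; exact: sigma_process_increment.
  + by apply: sigma_process_bigcap => i; exact: sigma_process_increment.
  rewrite iX// iY// -big_split/=; apply: eq_bigr => i _; rewrite hZ XY//.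
  + exact: sigma_process_increment.
  + exact: sigma_process_increment.
- move=> i; rewrite -[X in measurable X]setTI.
  by apply: (measurable_funB measurable_fst measurable_snd).
Qed.

(** The joint law of a pair of increments is the product of two laws that only
    depend on the length of the time interval. *)
Lemma stationary_increments_diff X Y :
  independent_processes X Y -> stationary_increments X ->
  stationary_increments Y -> stationary_increments (diff_process X Y).
Proof.
move=> XY sX sY s t s0 st A mA.
have t0 : 0 <= t by exact: le_trans st.
pose Z a b w := (increment X a b w, increment Y a b w).
pose E := (fun z : R * R => z.1 - z.2) @^-1` A.
have DE a b : increment (diff_process X Y) a b @^-1` A = Z a b @^-1` E.
  by rewrite increment_diff.
rewrite !DE.
have mZ a b : measurable_fun setT (Z a b).
  by apply: measurable_fun_pair; exact: measurable_increment.
have ts0 : 0 <= t - s by rewrite subr_ge0.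
suff : pushforward P (Z s t) E = pushforward P (Z 0 (t - s)) E by [].
apply: eq_measure_rectangles.
- by rewrite [X in (X < _)%E](@probability_setT _ _ _ P) ltry.
- move=> B C mB mC; rewrite /pushforward.
  change (P (increment X s t @^-1` B `&` increment Y s t @^-1` C) =
    P (increment X 0 (t - s) @^-1` B `&` increment Y 0 (t - s) @^-1` C)).
  rewrite !XY; do ?[exact: sigma_process_increment].
  by rewrite sX// sY.
- rewrite -[X in measurable X]setTI.
  by apply: (measurable_funB measurable_fst measurable_snd).
Qed.

(** An increment of the difference exceeds [e] only if one of the two
    increments exceeds [e / 2]. *)
Lemma stochastically_continuous_diff X Y :
  stochastically_continuous X -> stochastically_continuous Y ->
  stochastically_continuous (diff_process X Y).
Proof.
move=> cX cY s e s0 e0.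
have e20 : 0 < e / 2 by rewrite divr_gt0.
have mE (W : process P) r t : measurable [set w | r < `|increment W s t w|].
  have -> : [set w | r < `|increment W s t w|] =
      (fun w => `|increment W s t w|) @^-1` `]r, +oo[.
    by apply/seteqP; split => w /=; rewrite in_itv/= andbT.
  rewrite -[X in measurable X]setTI.
  by apply: (measurableT_comp _ (measurable_increment W s t)).
pose U (W : process P) t := [set w | e / 2 < `|increment W s t w|].
apply: (@squeeze_cvge _ _ _ _ (cst 0%E) _ (fun t => (P (U X t) + P (U Y t))%E)).
- near=> t; rewrite measure_ge0/=.
  apply: (@le_trans _ _ (P (U X t `|` U Y t))); last first.
    by apply: measureU2; exact: mE.
  apply: le_measure; rewrite ?inE//; first by apply: measurableU; exact: mE.
  move=> w /=; rewrite increment_diff => he.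
  have [h1|h1] := ltP (e / 2) `|increment X s t w|; [by left|right].
  rewrite /U/= ltNge; apply/negP => h2.
  by have := ler_normB (increment X s t w) (increment Y s t w); lra.
- exact: cvg_cst.
- rewrite -[X in _ --> X]adde0; apply: cvgeD => //; [exact: cX|exact: cY].
Unshelve. all: by end_near. Qed.

Lemma levy_process_diff X Y : independent_processes X Y ->
  levy_process X -> levy_process Y -> levy_process (diff_process X Y).
Proof.
move=> XY [X0 iX sX cX] [Y0 iY sY cY]; split.
- apply: filterS2 X0 Y0 => w X0 Y0.
  by rewrite [LHS](_ : _ = X 0 w - Y 0 w)// X0 Y0 subrr.
- exact: independent_increments_diff.
- exact: stationary_increments_diff.
- exact: stochastically_continuous_diff.
Qed.
End difference_levy.

(** * The Levy measure *)

Section two_sided_jump_measure.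
Context {R : realType}.
Variables (a b : {nonneg R}) (p q : nat -> R) (k : nat).

Definition jump_measure : {measure set R -> \bar R} :=
  measure_add (mscale a (msum (fun j => \d_(p j)) k))
              (mscale b (msum (fun j => \d_(q j)) k)).

Definition jump_sum (f : R -> R) : R :=
  a%:num * (\sum_(j < k) f (p j)) + b%:num * (\sum_(j < k) f (q j)).

Lemma ge0_integral_jump_measure (f : R -> R) : measurable_fun setT f ->
  (forall x, 0 <= f x) -> (\int[jump_measure]_x (f x)%:E = (jump_sum f)%:E)%E.
Proof.
move=> mf f0.
have mF : measurable_fun setT (fun x => (f x)%:E) by exact/measurable_EFinP.
have F0 x : setT x -> (0 <= (f x)%:E)%E by rewrite lee_fin.
have diracE (r : nat -> R) :
    (\int[msum (fun j => \d_(r j)) k]_x (f x)%:E = (\sum_(j < k) f (r j))%:E)%E.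
  rewrite ge0_integral_measure_sum// -sumEFin; apply: eq_bigr => j _.
  by rewrite integral_dirac// diracT mul1e.
by rewrite ge0_integral_measure_add// !ge0_integral_mscale// !diracE.
Qed.

(** Splitting [f] into positive and negative parts spares a discussion of
    integrability, both integrals being finite sums. *)
Lemma Rintegral_jump_measure (f : R -> R) : measurable_fun setT f ->
  Rintegral jump_measure setT f = jump_sum f.
Proof.
move=> mf; rewrite /Rintegral integralE.
have -> : (\int[jump_measure]_x (fun x => (f x)%:E)^\+ x =
    (jump_sum (fun x => Num.max (f x) 0))%:E)%E.
  rewrite -ge0_integral_jump_measure//.
  - by apply: eq_integral => x _; rewrite funeposE EFin_max.
  - exact: measurable_maxr.
  - by move=> x; rewrite le_max lexx orbT.
have -> : (\int[jump_measure]_x (fun x => (f x)%:E)^\- x =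
    (jump_sum (fun x => Num.max (- f x) 0))%:E)%E.
  rewrite -ge0_integral_jump_measure//.
  - by apply: eq_integral => x _; rewrite funenegE EFin_max.
  - by apply: measurable_maxr => //; exact: measurableT_comp.
  - by move=> x; rewrite le_max lexx orbT.
have fE x : f x = Num.max (f x) 0 - Num.max (- f x) 0.
  by rewrite /Num.max oppr_lt0; case: ltgtP => h; lra.
rewrite -EFinB /= /jump_sum.
under [in RHS]eq_bigr do rewrite fE.
under [X in _ = _ + _ * X]eq_bigr do rewrite fE.
by rewrite !sumrB; ring.
Qed.
End two_sided_jump_measure.

Theorem proposition4p3 (d : measure_display) (T : measurableType d)
    (R : realType) (P : probability T R) (k : nat) (lambda1 lambda2 : R)
    (hk : (1 <= k)%N) (h1 : 0 < lambda1) (h2 : 0 < lambda2)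
    (N1 N2 : process P)
    (hN1 : poisson_process_order k lambda1 N1)
    (hN2 : poisson_process_order k lambda2 N2)
    (hN : independent_processes N1 N2) :
  is_levy_measure (diff_process N1 N2)
    (measure_add
       (mscale (NngNum (ltW h1)) (msum (fun j => \d_(j.+1%:R : R)) k))
       (mscale (NngNum (ltW h2)) (msum (fun j => \d_(- j.+1%:R : R)) k))).
Proof.
set nu := (X in is_levy_measure _ X).
have nuE : nu = jump_measure (NngNum (ltW h1)) (NngNum (ltW h2))
    (fun j => j.+1%:R) (fun j => - j.+1%:R) k by [].
rewrite nuE {nu nuE}; set nu := jump_measure _ _ _ _ _.
pose S := @jump_sum R (NngNum (ltW h1)) (NngNum (ltW h2)) (fun j => j.+1%:R)
  (fun j => - j.+1%:R) k.
have SE f : measurable_fun setT f -> Rintegral nu setT f = S f.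
  exact: Rintegral_jump_measure.
split.
- by apply: levy_process_diff => //; [case: hN1|case: hN2].
- split.
    rewrite -[X in nu X]setIT -integral_indic//.
    rewrite ge0_integral_jump_measure//.
      by rewrite /jump_sum !big1 ?mulr0 ?addr0// => j _; rewrite indicE memNset//=;
        apply/eqP; rewrite ?oppr_eq0 pnatr_eq0.
  rewrite ge0_integral_jump_measure ?ltry//.
  - by apply: measurable_minr => //; exact: measurable_funX.
  - by move=> x; rewrite le_min ler01 sqr_ge0.
- (* The integral of [small] is the drift that offsets the compensator. *)
  pose small := fun x : R => x * \1_[set y : R | `|y| <= 1] x.
  have msmall : measurable_fun setT small.
    apply: measurable_funM => //; apply: measurable_indic.
    have -> : [set y : R | `|y| <= 1] = `[-1, 1]%classic.
      by apply/seteqP; split => y /=; rewrite ler_norml in_itv.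
    exact: measurable_itv.
  exists (S small), 0; split => // t u t0.
  rewrite (charfun_of_cos
    (fun x => expectation_cos_skellam u x h1 h2 hN1 hN2 hN t0)).
  have -> : levy_exponent (S small) 0 nu u =
    (S (fun x => cos (u * x) - 1) +i* S (fun x => sin (u * x)))%C.
    have mu1 : measurable_fun setT (fun x : R => u * x) by exact: measurable_funM.
    rewrite /levy_exponent; set I := Cintegral _ _.
    have -> : I = (S (fun x => cos (u * x) - 1) +i*
        S (fun x => sin (u * x) - u * small x))%C.
      congr (_ +i* _)%C.
      - rewrite -SE.
          apply: eq_Rintegral => x _.
          change (expR 0 * cos (u * x) - 1 - 0 = cos (u * x) - 1).
          by rewrite expR0 mul1r subr0.
        apply: measurable_funB => //.
        exact: (measurableT_comp (@measurable_fun_cos R)).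
      - rewrite -SE.
          apply: eq_Rintegral => x _.
          change (expR 0 * sin (u * x) - 0 - u * x * \1_[set y : R | `|y| <= 1] x =
            sin (u * x) - u * small x).
          by rewrite expR0 mul1r subr0 /small mulrA.
        apply: measurable_funB; last exact: measurable_funM.
        apply: (measurableT_comp _ mu1).
        by apply: continuous_measurable_fun; exact: continuous_sin.
    set A := S (fun x => cos _ - 1).
    (* Complex arithmetic computes to real and imaginary parts. *)
    change (((0 - 0 * u ^+ 2 / 2 + A) +i*
        (S small * u - 0 + S (fun x => sin (u * x) - u * small x)))%C =
      (A +i* S (fun x => sin (u * x)))%C).
    congr (_ +i* _)%C; first by rewrite !mul0r subrr add0r.
    by rewrite /S /jump_sum !sumrB -!mulr_sumr; ring.
  change (cexp _) with (cexp
    ((t * S (fun x => cos (u * x) - 1) - 0 * S (fun x => sin (u * x))) +i*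
     (t * S (fun x => sin (u * x)) + 0 * S (fun x => cos (u * x) - 1)))%C).
  rewrite /cexp/= !mul0r subr0 addr0.
  have -> : poisson_phase k lambda1 t u + poisson_phase k lambda2 t (- u) =
      t * S (fun x => sin (u * x)).
    rewrite /poisson_phase /S /jump_sum /= mulrDr; congr (_ + _);
      rewrite !mulr_sumr; apply: eq_bigr => j _; rewrite mulrA [t * _]mulrC.
      by rewrite [u * _]mulrC.
    by rewrite [u * _]mulrC mulrN mulNr.
  have -> : poisson_modulus k lambda1 t u * poisson_modulus k lambda2 t (- u) =
      expR (t * S (fun x => cos (u * x) - 1)).
    rewrite /poisson_modulus -expRD /S /jump_sum /= mulrDr; congr (expR (_ + _));
      rewrite !mulr_sumr; apply: eq_bigr => j _; rewrite mulrA [t * _]mulrC.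
      by rewrite [u * _]mulrC.
    by rewrite [u * _]mulrC mulrN mulNr.
  by [].
Qed.
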